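(* If $f\colon\mathbb{Z}_+\to[0,\infty)$ is an unbounded canonical function, then the bounded density subshift $(\Psi_f,\sigma)$ generated by $f$ has the multiple IP-recurrence property.
   Context: $\mathbb{N}$ and $\mathbb{Z}_+$ are the sets of positive and nonnegative integers. For $f\colon\mathbb{Z}_+\to[0,\infty)$, the bounded density subshift generated by $f$ is \[\Psi_f=\Bigl\{x\in\{0,1\}^{\mathbb{N}}:\ \forall p\in\mathbb{Z}_+,\ \forall i\in\mathbb{N},\ \sum_{r=i}^{i+p-1}x_r\le f(p)\Bigr\},\] with the topology induced from the product topology on $\{0,1\}^{\mathbb{N}}$ and the shift map $\sigma(x)_n=x_{n+1}$. The function $f$ is canonical if: (1) $f(0)=0$; (2) $f(m+1)\in f(m)+\mathbb{Z}_+$ for all $m\in\mathbb{Z}_+$; (3) $f(m+n)\le f(m)+f(n)$ for all $m,n\in\mathbb{Z}_+$. A system $(X,T)$ ($X$ compact metric, $T\colon X\to X$ continuous) has the multiple IP-recurrence property if for every non-empty open $U\subset X$, every $d\ge1$ and all sequences $\{p_i^{(1)}\}_{i=1}^\infty,\dots,\{p_i^{(d)}\}_{i=1}^\infty$ in $\mathbb{N}$ (generating the IP-sets $FS\{p_i^{(j)}\}_{i=1}^\infty$ of all sums $\sum_{i\in\alpha}p_i^{(j)}$ over non-empty finite $\alpha\subset\mathbb{N}$), there exists a non-empty finite subset $\alpha$ of $\mathbb{N}$ such that \[U\cap T^{-\sum_{i\in\alpha}p_i^{(1)}}U\cap T^{-\sum_{i\in\alpha}p_i^{(2)}}U\cap\dots\cap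 T^{-\sum_{i\in\alpha}p_i^{(d)}}U\ne\emptyset.\] *)

(* Defs.v *)
From HB Require Import structures.
From mathcomp Require Import all_boot all_order all_algebra finmap.
From mathcomp Require Import all_classical all_reals all_analysis.

Set Implicit Arguments.
Unset Strict Implicit.
Unset Printing Implicit Defensive.

Import Order.TTheory GRing.Theory Num.Theory.
Local Open Scope classical_set_scope.
Local Open Scope ring_scope.

(* Sequences in {0,1}^N are points of [cantor_space] (bool^nat with the       *)
(* product topology), so the positions 1, 2, 3, ... are numbered 0, 1, 2, ... *)

Section BoundedDensity.
Context {R : realType}.
Implicit Types f : nat -> R.

Definition canonical_fun f : Prop :=
  [/\ f 0%N = 0,
      forall m : nat, exists k : nat, f m.+1 = f m + k%:R
    & forall m n : nat, f (m + n)%N <= f m + f n].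

Definition bounded_density f : set cantor_space :=
  [set x | forall p i : nat, (\sum_(i <= r < i + p) (x r : nat))%N%:R <= f p].

Definition shift (x : cantor_space) : cantor_space := fun n => x n.+1.

Lemma bounded_density_shift f (x : cantor_space) :
  bounded_density f x -> bounded_density f (shift x).
Proof.
move=> fx p i; have := fx p i.+1.
by rewrite addSn big_add1.
Qed.

(* The subset [bounded_density f], used as a type, carries the topology       *)
(* induced from [cantor_space] (subtype_topology in MathComp-Analysis).       *)
Definition bd_shift f (x : bounded_density f) : bounded_density f :=
  exist _ (shift (set_val x))
    (mem_set (bounded_density_shift (set_mem (svalP x)))).

Lemma bd_shiftE f (x : bounded_density f) :
  set_val (bd_shift x) = shift (set_val x).
Proof. by []. Qed.

Lemma near_prefix (x : cantor_space) (n : nat) :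
  nbhs x [set y : cantor_space | forall r, (r < n)%N -> y r = x r].
Proof.
elim: n => [|n IHn]; first by apply: filterS filterT => y _ r; rewrite ltn0.
have xn : nbhs x [set y : cantor_space | y n = x n].
  apply: (@proj_continuous _ (fun=> bool) n x [set b | b = x n]).
  exact: (discrete_set1 (x n)).
apply: filterS (filterI IHn xn) => y [yx yxn] r.
by rewrite ltnS leq_eqVlt => /predU1P[->|/yx].
Qed.

Lemma bounded_density_closed f : closed (bounded_density f).
Proof.
rewrite closedE => x /= xN p i; apply: contrapT => nx; apply: xN.
apply: filterS (near_prefix x (i + p)) => y yx fy; apply: nx.
rewrite (eq_big_nat _ _ (F2 := fun r => (y r : nat))) //.
by move=> r /andP[_ ri]; rewrite yx.
Qed.

Lemma bounded_density_compact f : compact (bounded_density f).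
Proof.
exact: subclosed_compact (@bounded_density_closed f) cantor_space_compact _.
Qed.

Lemma shift_continuous : continuous shift.
Proof.
move=> x; apply/(@cvg_sup cantor_space nat) => n.
apply/cvg_image; first by rewrite eqEsubset; split=> // b _; exists (fun=> b).
move=> A /= nA; exists (proj n @^-1` A).
  apply: (@proj_continuous _ (fun=> bool) n.+1 x A nA).
rewrite eqEsubset; split=> b; first by case=> y Ay <-.
by move=> Ab; exists (fun=> b).
Qed.

Lemma bd_shift_continuous f : continuous (@bd_shift f).
Proof.
apply: continuous_comp_initial => x.
apply: (@continuous_comp _ _ _ set_val shift); last exact: shift_continuous.
exact: initial_continuous.
Qed.

End BoundedDensity.

(* The definition only needs the topology of X and the map T; it is meant for *)
(* X compact metrizable and T continuous. For the subshift this holds by      *)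
(* [bounded_density_compact], [bd_shift_continuous].                          *)
(* A finite subset of {1, 2, 3, ...} is a [{fset nat}], indices starting at 0.*)
Definition multiple_IP_recurrence (X : topologicalType) (T : X -> X) : Prop :=
  forall U : set X, open U -> U !=set0 ->
  forall d : nat, (1 <= d)%N ->
  forall p : 'I_d -> nat -> nat, (forall j i, (0 < p j i)%N) ->
  exists2 alpha : {fset nat}, alpha != fset0 &
    U `&` \bigcap_(j in [set: 'I_d])
            (iter (\sum_(i <- alpha) p j i)%N T @^-1` U) !=set0.

(* Main.v *)
Require Import Defs.
From mathcomp Require Import all_boot all_order all_algebra finmap.
From mathcomp Require Import all_classical all_reals all_analysis.
From mathcomp Require Import zify.
Import Order.TTheory GRing.Theory Num.Theory.
Local Open Scope classical_set_scope.
Local Open Scope ring_scope.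

(** A non-empty open set contains a cylinder: all points of the subshift that
    start with the same word u of length n as some point x. The plan is to find
    alpha and a point y of the subshift carrying a copy of u at 0 and at each of
    the d return times, and 0 everywhere else.

    The danger is that two return times are distinct but close, so that copies
    of u overlap or crowd each other. This is avoided by a congruence trick: fix
    a modulus L; among the partial sums of the vectors (p_i^(1), ..., p_i^(d))
    taken mod L two agree, so a block alpha of consecutive indices makes all d
    return times multiples of L ([exists_block_sum_dvdn]). Distinct multiples of
    L are at distance at least L, whatever the sequences are.

    It remains to choose L. As f is nondecreasing and unbounded, there is M with
    f M >= (d + 1) n; take L = n + M. A window of length at least M contains at
    most (d + 1) n ones of y, which f allows. A window of length p < M is
    shorter than the gap between two copies, so its ones come from one copy of
    u, and there are at most f p of them because x is in the subshift
    ([bounded_density_copies]). *)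

(** * Cylinders *)

(** The filter generated by the cylinders around [x] converges to [x], because
    convergence in a product is convergence of each coordinate, and coordinate
    [n] is constant on a cylinder of length [n.+1]. *)
Lemma nbhs_cylinder (x : cantor_space) (A : set cantor_space) : nbhs x A ->
  exists n, [set y : cantor_space | forall r, (r < n)%N -> y r = x r] `<=` A.
Proof.
pose C n := [set y : cantor_space | forall r, (r < n)%N -> y r = x r].
pose F := filter_from [set: nat] C.
have FF : ProperFilter F.
  apply: filter_from_proper; last by move=> n _; exists x.
  apply: filter_from_filter; first by exists 0%N.
  move=> m n _ _; exists (maxn m n) => // y yx.
  by split=> r rn; apply: yx; rewrite leq_max rn ?orbT.
suff Fx : F --> x by move=> /Fx[n _ nA]; exists n.
apply/(@cvg_sup cantor_space nat) => n.
apply/cvg_image; first by rewrite eqEsubset; split=> // b _; exists (fun=> b).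
move=> B /= /nbhs_singleton Bx; exists (proj n @^-1` B).
  by exists n.+1 => // y yx; rewrite /= /proj yx.
rewrite eqEsubset; split=> b; first by case=> y By <-.
by move=> Bb; exists (fun=> b).
Qed.

Lemma open_bd_cylinder (R : realType) (f : nat -> R)
    (U : set (bounded_density f)) (x : bounded_density f) : open U -> U x ->
  exists n, forall y : bounded_density f,
    (forall r, (r < n)%N -> set_val y r = set_val x r) -> U y.
Proof.
move=> [V oV <-] Vx.
have [n nV] := nbhs_cylinder _ _ (open_nbhs_nbhs (conj oV Vx)).
by exists n => y yx; apply: nV.
Qed.

Lemma iter_bd_shiftE (R : realType) (f : nat -> R) (y : bounded_density f)
    (k r : nat) :
  set_val (iter k (@bd_shift R f) y) r = set_val y (r + k)%N.
Proof.
elim: k r => [|k IHk] r; first by rewrite addn0.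
by rewrite -addSnnS; exact: IHk r.+1.
Qed.

(** * Return times divisible by a given modulus *)

(** Pigeonhole on the partial sums mod [L]: when two of them agree, the indices
    in between form the block. *)
Lemma exists_block_sum_dvdn (I : finType) (p : I -> nat -> nat) (L : nat) :
  (0 < L)%N -> exists a b, (a < b)%N /\
    forall j, (L %| \sum_(a <= i < b) p j i)%N.
Proof.
move=> L_gt0.
pose s m : {ffun I -> 'I_L} :=
  [ffun j => Ordinal (ltn_pmod (\sum_(0 <= i < m) p j i) L_gt0)].
pose N := #|{ffun I -> 'I_L}|.
have /injectivePn[a [b ab sab]] : ~~ injectiveb (fun m : 'I_N.+1 => s m).
  apply/negP => /injectiveP /leq_card.
  by rewrite card_ord ltnn.
wlog ltab : a b ab sab / (a < b)%N.
  move=> H; have [|ba|/val_inj abE] := ltngtP a b; first exact: H.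
    by apply: (H b a); rewrite // eq_sym.
  by rewrite abE eqxx in ab.
exists (val a), (val b); split=> // j.
have /(congr1 val) := congr1 (fun g : {ffun I -> 'I_L} => g j) sab.
rewrite !ffunE /= => /esym/eqP.
rewrite (@big_cat_nat _ _ _ a 0 b) //=; last exact: ltnW.
by rewrite -[X in (_ == X %[mod _])%N]addn0 eqn_modDl mod0n.
Qed.

(** * Sparse copies of a word *)

(** [S] lists the quotients by [L] of the positions of the copies. With
    quotients, repetitions in [S] are harmless and copies cannot overlap:
    position [r] can only belong to the slot [r %/ L]. *)
Definition copies (u : nat -> bool) (n L : nat) (S : seq nat) : cantor_space :=
  fun r => [&& (r %/ L)%N \in S, (r %% L < n)%N & u (r %% L)%N].

Lemma copiesE u n L S q k : (k < n)%N -> (n <= L)%N -> q \in S ->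
  copies u n L S (k + q * L)%N = u k.
Proof.
move=> kn nL qS; have kL := leq_trans kn nL.
have L_gt0 : (0 < L)%N by apply: leq_ltn_trans kL.
rewrite /copies addnC divnMDl // modnMDl modn_small // divn_small // addn0.
by rewrite qS kn.
Qed.

Lemma sum_copies_le_size u n L S i p :
  (\sum_(i <= r < i + p) copies u n L S r <= size S * n)%N.
Proof.
have -> : (\sum_(i <= r < i + p) copies u n L S r)%N =
    count (copies u n L S) (index_iota i (i + p)).
  by rewrite -sum1_count [RHS]big_mkcond; apply: eq_bigr => r _; case: copies.
rewrite -size_filter -{2}(size_iota 0 n).
rewrite -(size_allpairs (fun q k => q * L + k)%N).
apply: uniq_leq_size; first by rewrite filter_uniq // iota_uniq.
move=> r; rewrite mem_filter => /andP[/and3P[rS rn _] _].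
rewrite (divn_eq r L); apply: allpairs_f => //.
by rewrite mem_iota.
Qed.

(** A window that starts after the word of its slot of length [L] and is no
    longer than the gap is padded with the rest of the slot, all zeros. What
    remains starts at the next copy, so both cases reduce to a window inside
    one slot, where the count is one for [x]. *)
Lemma bounded_density_copies (R : realType) (f : nat -> R) (x : cantor_space)
    (n M : nat) (S : seq nat) :
  {homo f : a b / (a <= b)%N >-> a <= b} -> bounded_density f x ->
  (size S * n)%N%:R <= f M ->
  bounded_density f (copies x n (n + M) S).
Proof.
move=> f_homo fx fM p i; set L := (n + M)%N; set y := copies x n L S.
have [Mp|pM] := leqP M p.
  apply: le_trans (f_homo _ _ Mp); apply: le_trans fM.
  by rewrite ler_nat sum_copies_le_size.
have yx k q : (k < L)%N -> (y (k + q * L)%N <= x k)%N.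
  move=> kL; have L_gt0 : (0 < L)%N by apply: leq_ltn_trans kL.
  rewrite /y /copies [(k + _)%N]addnC modnMDl modn_small //.
  by case: (x k); rewrite ?andbF // leq_b1.
have slot k q : (k + p <= L)%N ->
    (\sum_(k + q * L <= r < k + q * L + p) y r)%N%:R <= f p.
  move=> kpL; apply: le_trans (fx p k); rewrite ler_nat.
  rewrite addnAC big_addn addnK !big_nat leq_sum // => r /andP[_ rkp].
  by apply: yx; apply: leq_trans rkp kpL.
have [kpL|Lkp] := leqP (i %% L + p) L.
  by rewrite (divn_eq i L) [(_ * L + _)%N]addnC slot.
have iE := divn_eq i L.
set q := (i %/ L)%N in iE; set k := (i %% L)%N in iE Lkp.
have L_gt0 : (0 < L)%N by rewrite /L; lia.
have kL : (k < L)%N by rewrite ltn_pmod.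
have nk : (n <= k)%N by rewrite /L in Lkp; lia.
have i_next : (i <= q.+1 * L)%N by rewrite mulSn; lia.
have zeros : (\sum_(i <= r < q.+1 * L) y r = 0)%N.
  apply: big1_seq => r /andP[_]; rewrite mem_index_iota => /andP[ir rq].
  have -> : r = (q * L + (r - q * L))%N by lia.
  rewrite /y /copies modnMDl [((r - _) %% L)%N]modn_small; last first.
    by rewrite mulSn in rq; lia.
  have -> : (r - q * L < n)%N = false by lia.
  by rewrite andbF.
have := slot 0%N q.+1; rewrite !add0n => next.
apply: le_trans (next _); last by rewrite /L; lia.
have padded : (\sum_(i <= r < q.+1 * L + p) y r =
    \sum_(q.+1 * L <= r < q.+1 * L + p) y r)%N.
  by rewrite (@big_cat_nat _ _ _ (q.+1 * L)) ?leq_addr //= zeros.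
rewrite ler_nat -padded [leqRHS](@big_cat_nat _ _ _ (i + p)) ?leq_addr //.
by rewrite leq_add2r.
Qed.

(** * Multiple IP-recurrence *)

Lemma unbounded_exists_ge (R : realType) (f : nat -> R) (c : R) :
  ~ has_ubound (range f) -> exists M, c <= f M.
Proof.
move=> f_unb; apply: contrapT => nf; apply: f_unb; exists c => _ [m _ <-].
by rewrite leNgt; apply/negP => cf; apply: nf; exists m; apply: ltW.
Qed.

Theorem theorem5p5 (R : realType) (f : nat -> R)
    (f_ge0 : forall n : nat, 0 <= f n)
    (f_canonical : canonical_fun f)
    (f_unbounded : ~ has_ubound (range f)) :
  multiple_IP_recurrence (@bd_shift R f).
Proof.
move=> U oU [x Ux] d _ p p_gt0; have [_ f_step _] := f_canonical.
have f_homo : {homo f : a b / (a <= b)%N >-> a <= b}.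
  apply: homo_leq => [//|a b c|m]; first exact: le_trans.
  by have [k ->] := f_step m; rewrite lerDl.
have [n nU] := open_bd_cylinder _ _ _ _ oU Ux.
(* Words of length [n.+1] rather than [n] keep the modulus positive. *)
have [M fM] := unbounded_exists_ge _ _ (d.+1 * n.+1)%N%:R f_unbounded.
pose L := (n.+1 + M)%N.
have [a [b [ab Ldvd]]] := exists_block_sum_dvdn _ p L isT.
pose alpha : {fset nat} := [fset i in index_iota a b]%fset.
have alphaE j : (\sum_(i <- alpha) p j i = \sum_(a <= i < b) p j i)%N.
  apply: perm_big; apply: uniq_perm; rewrite ?fset_uniq ?iota_uniq // => i.
  by rewrite in_fset.
pose S := 0%N :: [seq ((\sum_(i <- alpha) p j i) %/ L)%N | j <- enum 'I_d].
have yP : bounded_density f (copies (set_val x) n.+1 L S).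
  apply: bounded_density_copies => //; first exact: set_mem (svalP x).
  by rewrite /= size_map size_enum_ord.
pose y : bounded_density f :=
  exist (fun z => z \in bounded_density f) _ (mem_set yP).
have yE q k : (k < n.+1)%N -> q \in S -> set_val y (k + q * L)%N = set_val x k.
  by move=> kn qS; apply: copiesE; rewrite // leq_addr.
exists alpha.
  by apply/fset0Pn; exists a; rewrite in_fset /= mem_index_iota leqnn ab.
exists y; split.
  by apply: nU => r rn; rewrite -(yE 0%N r (ltnW rn)) ?mem_head // mul0n addn0.
move=> j _; apply: nU => r rn.
have := divnK (Ldvd j); rewrite -alphaE iter_bd_shiftE => <-.
apply: yE; first exact: ltnW.
rewrite in_cons; apply/orP; right.
by apply/mapP; exists j; rewrite ?mem_enum.
Qed.
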